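(* Let $N=2$ and let $F\in GL_2(\mathbb C)$ satisfy $F\overline F=\varepsilon I_2$ for some $\varepsilon\in\{\pm1\}$ and $F^*F=I_2$. Let $(i,j,k)=(s+t,r+t,r+s)$ be admissible ($r,s,t\in\mathbb N_0$), and let $a=a^*\in V_i$, $b=b^*\in V_j$, and $c=c^*\in V_k$. Put $$\widetilde c_{rst}=\min\left\{\sqrt{\frac{d_jd_k}{d_i}},\ \sqrt{\frac{d_id_k}{d_j}},\ \sqrt{\frac{d_id_j}{d_k}}\right\}.$$ Then $$|h(abc)|\leq\widetilde c_{rst}\,\|a\|_2\|b\|_2\|c\|_2.$$ Moreover, with $\eta_{rs}=\left(\frac{d_rd_s}{d_{r+s}}\right)^{1/2}$ and $\gamma_2=\frac{\sqrt5}{2}$, one has $$\widetilde c_{rs0}=\eta_{rs},\qquad r,s\geq 1,$$ and $$\widetilde c_{rst}\leq\gamma_2^3\,\eta_{rs}\eta_{rt}\eta_{st},\qquad r,s,t\geq 1.$$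
   Context: Let $N\ge 2$ and $F\in GL_N(\mathbb C)$ with $F\overline F=\pm I_N$ and $F^*F=I_N$ ($\overline F$ is the entrywise complex conjugate); here $N=2$. The free orthogonal quantum group $O_F^+$ is the compact quantum group whose $C^*$-algebra $C(O_F^+)$ is the universal unital $C^*$-algebra generated by the entries of a unitary matrix $u^1=(u^1_{ij})_{1\le i,j\le N}$ subject to $u^1=F\,\overline{u^1}\,F^{-1}$, where $\overline{u^1}=((u^1_{ij})^* )$, with coproduct $\Delta(u^1_{ij})=\sum_{k}u^1_{ik}\otimes u^1_{kj}$. Since $F$ is unitary, $O_F^+$ is of Kac type: its Haar state $h$ is a trace. $L_2(O_F^+)$ is the GNS Hilbert space of $h$, with $\|x\|_2=h(x^*x)^{1/2}$. The irreducible unitary representations of $O_F^+$ are, up to equivalence, $u^k=(u^k_{ij})_{1\le i,j\le d_k}$, $k\in\mathbb N_0=\{0,1,2,\dots\}$, with $u^0=\mathbf 1$, $u^1$ the fundamental representation above, and fusion rules $u^i\otimes u^j\simeq u^{|i-j|}\oplus u^{|i-j|+2}\oplus\cdots\oplus u^{i+j}$. Put $V_k=\operatorname{span}\{u^k_{ij}:1\le i,j\le d_k\}$; then $L_2(O_F^+)=\bigoplus_{k\ge0}V_k$ orthogonally. For $N=2$ the dimensions are $d_k=k+1$. A triple $(i,j,k)\in\mathbb N_0^3$ is admissible if $|i-j|\le k\le i+j$ and $i+j+k$ is even; equivalently $(i,j,k)=(s+t,r+t,r+s)$ with $r=\frac{j+k-i}2$, $s=\frac{i+k-j}2$, $t=\frac{i+j-k}2$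 in $\mathbb N_0$. *)

(* Defs.v *)
From HB Require Import structures.
From mathcomp Require Import all_boot all_order all_algebra.
From mathcomp Require Import all_classical all_reals.
From mathcomp Require Import complex mxtens.

Set Implicit Arguments.
Unset Strict Implicit.
Unset Printing Implicit Defensive.

Import Order.TTheory GRing.Theory Num.Theory.

Local Open Scope classical_set_scope.
Local Open Scope ring_scope.
Local Open Scope complex_scope.

(* Nonzero unital complex C*-algebras.  The norm is a separate operation: the
   ordered-field hierarchy already joins rings and norms, so HB accepts no further
   structure that is both an algebra and a normed module. *)
HB.mixin Record isCStarAlgebra (R : realType) A of GRing.Algebra R[i] A := {
  star : A -> A ;
  cnorm : A -> R ;
  starD : forall x y : A, star (x + y) = star x + star y ;
  starZ : forall (l : R[i]) (x : A), star (l *: x) = Num.conj l *: star x ;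
  starM : forall x y : A, star (x * y) = star y * star x ;
  starK : forall x : A, star (star x) = x ;
  cnorm_eq0 : forall x : A, cnorm x = 0 -> x = 0 ;
  cnormD : forall x y : A, cnorm (x + y) <= cnorm x + cnorm y ;
  cnormZ : forall (l : R[i]) (x : A),
    (cnorm (l *: x))%:C = `|l| * (cnorm x)%:C ;
  cnormM : forall x y : A, cnorm (x * y) <= cnorm x * cnorm y ;
  cnorm_star : forall x : A, cnorm (star x * x) = cnorm x ^+ 2 ;
  cnorm_complete : forall f : nat -> A,
    (forall e : R, 0 < e -> exists n0 : nat, forall m n : nat,
       (n0 <= m)%N -> (n0 <= n)%N -> cnorm (f m - f n) < e) ->
    exists l : A, forall e : R, 0 < e -> exists n0 : nat, forall n : nat,
       (n0 <= n)%N -> cnorm (f n - l) < e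
}.

#[short(type="cstarAlgType")]
HB.structure Definition CStarAlgebra (R : realType) :=
  { A of isCStarAlgebra R A & GRing.Algebra R[i] A }.

Section CStar.
Variable R : realType.
Local Notation C := R[i].
Implicit Types A B T : cstarAlgType R.

Definition star_morphism A B (f : {lrmorphism A -> B}) : Prop :=
  forall x, f (star x) = star (f x).

Definition is_state A (phi : {scalar A}) : Prop :=
  (forall x, 0 <= phi (star x * x)) /\ phi 1 = 1.

Definition nclosure A (S : set A) : set A :=
  [set x | forall e : R, 0 < e -> exists2 y, S y & cnorm (x - y) < e].

Definition bounded_map A B (f : A -> B) : Prop :=
  exists K : R, forall x, cnorm (f x) <= K * cnorm x.

Definition cstar_generated A (X : set A) : Prop :=
  forall S : set A, nclosure S `<=` S -> X `<=` S -> S 1 ->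
    (forall x y, S x -> S y -> S (x + y)) ->
    (forall (l : C) x, S x -> S (l *: x)) ->
    (forall x y, S x -> S y -> S (x * y)) ->
    (forall x, S x -> S (star x)) ->
    S = setT.

(* E1 = phi (x) id and E2 = id (x) psi, for iota1 a * iota2 b = a (x) b. *)
Definition is_slice1 A B T (iota1 : {lrmorphism A -> T})
    (iota2 : {lrmorphism B -> T}) (phi : {scalar A})
    (E : {linear T -> B}) : Prop :=
  bounded_map E /\ forall a b, E (iota1 a * iota2 b) = phi a *: b.

Definition is_slice2 A B T (iota1 : {lrmorphism A -> T})
    (iota2 : {lrmorphism B -> T}) (psi : {scalar B})
    (E : {linear T -> A}) : Prop :=
  bounded_map E /\ forall a b, E (iota1 a * iota2 b) = psi b *: a.

(* T is the minimal (spatial) C*-tensor product of A and B, with canonical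
   embeddings iota1 : a |-> a (x) 1 and iota2 : b |-> 1 (x) b.  A C*-completion
   of the algebraic tensor product has slice maps by all states, and it is the
   minimal one exactly when these slice maps separate its points. *)
Record is_min_tensor A B T (iota1 : {lrmorphism A -> T})
    (iota2 : {lrmorphism B -> T}) : Prop := {
  mt_star1 : star_morphism iota1 ;
  mt_star2 : star_morphism iota2 ;
  mt_comm : forall a b, iota1 a * iota2 b = iota2 b * iota1 a ;
  mt_dense : nclosure [set x : T | exists (n : nat) (a : 'I_n -> A)
      (b : 'I_n -> B), x = \sum_(l < n) iota1 (a l) * iota2 (b l)] = setT ;
  mt_slice1 : forall phi : {scalar A}, is_state phi ->
      exists E : {linear T -> B}, is_slice1 iota1 iota2 phi E ;
  mt_slice2 : forall psi : {scalar B}, is_state psi ->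
      exists E : {linear T -> A}, is_slice2 iota1 iota2 psi E ;
  mt_sep : forall x : T,
      (forall (phi : {scalar A}) (E : {linear T -> B}),
         is_state phi -> is_slice1 iota1 iota2 phi E -> E x = 0) ->
      (forall (psi : {scalar B}) (E : {linear T -> A}),
         is_state psi -> is_slice2 iota1 iota2 psi E -> E x = 0) ->
      x = 0
}.

Definition cmx A m n (M : 'M[C]_(m, n)) : 'M[A]_(m, n) :=
  map_mx (in_alg A) M.

Definition cadj m n (M : 'M[C]_(m, n)) : 'M[C]_(n, m) :=
  (map_mx Num.conj M)^T.

Definition mxstar A m n (v : 'M[A]_(m, n)) : 'M[A]_(m, n) := map_mx star v.

Definition unitary_mx A n (v : 'M[A]_n) : Prop :=
  v *m (mxstar v)^T = 1%:M /\ (mxstar v)^T *m v = 1%:M.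

Definition OF_relations N (F : 'M[C]_N) A (v : 'M[A]_N) : Prop :=
  unitary_mx v /\
  v = cmx A F *m mxstar v *m cmx A (invmx F).

(* (A, u) is C(O_F^+) with its fundamental unitary. *)
Definition is_universal_OF N (F : 'M[C]_N) A (u : 'M[A]_N) : Prop :=
  [/\ OF_relations F u,
      cstar_generated [set x | exists i j, x = u i j]
    & forall (B : cstarAlgType R) (v : 'M[B]_N), OF_relations F v ->
        exists2 f : {lrmorphism A -> B},
          star_morphism f & forall i j, f (u i j) = v i j].

Record is_OFplus N (F : 'M[C]_N) A T (iota1 iota2 : {lrmorphism A -> T})
    (Delta : {lrmorphism A -> T}) (u : 'M[A]_N) : Prop := {
  of_univ : is_universal_OF F u ;
  of_tensor : is_min_tensor iota1 iota2 ;
  of_delta_star : star_morphism Delta ;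
  of_delta : forall i j,
      Delta (u i j) = \sum_(k < N) iota1 (u i k) * iota2 (u k j)
}.

(* Haar state: (h (x) id) Delta = h(.) 1 = (id (x) h) Delta. *)
Record is_haar A T (iota1 iota2 Delta : {lrmorphism A -> T})
    (h : {scalar A}) : Prop := {
  haar_state : is_state h ;
  haar_left : forall E : {linear T -> A}, is_slice1 iota1 iota2 h E ->
      forall x, E (Delta x) = h x *: 1 ;
  haar_right : forall E : {linear T -> A}, is_slice2 iota1 iota2 h E ->
      forall x, E (Delta x) = h x *: 1
}.

Section Representations.
Variables (A T : cstarAlgType R) (iota1 iota2 Delta : {lrmorphism A -> T}).

Definition unitary_rep n (v : 'M[A]_n) : Prop :=
  unitary_mx v /\
  forall i j, Delta (v i j) = \sum_(k < n) iota1 (v i k) * iota2 (v k j).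

Definition irreducible_rep n (v : 'M[A]_n) : Prop :=
  forall M : 'M[C]_n, v *m cmx A M = cmx A M *m v ->
    exists l : C, M = l%:M.

Definition equiv_rep m n (v : 'M[A]_m) (w : 'M[A]_n) : Prop :=
  exists M : 'M[C]_(m, n),
    [/\ M *m cadj M = 1%:M, cadj M *m M = 1%:M
      & v *m cmx A M = cmx A M *m w].

(* The representation u^i (x) u^j is the Kronecker product of matrices over A
   (entries u^i_{ab} u^j_{cd}); `|i - j|, `|i - j| + 2, ..., i + j has
   minn i j + 1 terms.  The dimension d_k is k + 1, as N = 2. *)
Record is_irrep_system (w : 'M[A]_2) (u : forall k : nat, 'M[A]_k.+1)
    : Prop := {
  ir_rep : forall k, unitary_rep (u k) ;
  ir_irr : forall k, irreducible_rep (u k) ;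
  ir_inj : forall k l, equiv_rep (u k) (u l) -> k = l ;
  ir_surj : forall n (v : 'M[A]_n.+1), unitary_rep v -> irreducible_rep v ->
      exists k, equiv_rep v (u k) ;
  ir_0 : u 0%N = 1%:M ;
  ir_1 : u 1%N = w ;
  ir_fusion : forall i j, equiv_rep (tensmx (u i) (u j))
      (\mxdiag_(m < (minn i j).+1) u (`|i%:Z - j%:Z| + m.*2)%N)
}.

End Representations.

Definition Vspace A (u : forall k : nat, 'M[A]_k.+1) (k : nat) : set A :=
  [set a | exists X : 'M[C]_k.+1, a = \sum_p \sum_q X p q *: u k p q].

Definition l2norm A (h : {scalar A}) (x : A) : R :=
  Num.sqrt (complex.Re (h (star x * x))).

Definition dimO (k : nat) : R := k.+1%:R.

Definition ctilde (r s t : nat) : R :=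
  let i := (s + t)%N in let j := (r + t)%N in let k := (r + s)%N in
  Num.min (Num.sqrt (dimO j * dimO k / dimO i))
    (Num.min (Num.sqrt (dimO i * dimO k / dimO j))
             (Num.sqrt (dimO i * dimO j / dimO k))).

Definition eta (r s : nat) : R :=
  Num.sqrt (dimO r * dimO s / dimO (r + s)).

Definition gamma2 : R := Num.sqrt 5 / 2.

End CStar.

Arguments dimO {R} k.
Arguments ctilde {R} r s t.
Arguments eta {R} r s.
Arguments gamma2 {R}.

(* Main.v *)
(* By Schur's lemma the Haar state turns matrix coefficients of irreducible
   representations into an orthogonal system.  As F is unitary, the entrywise
   adjoint of the fundamental unitary is unitary; this passes to tensor products
   and subrepresentations, hence to every u^k, so that
   h (u^k_pa (u^k_qb)^* ) = h ((u^k_qb)^* u^k_pa) = [p = q][a = b] / d_k.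
   Writing a, b, c with coefficient matrices X, Y, Z, we get
   |a|_2^2 = |X|_HS^2 / d_i, and h (a b c^* ) = <V^T (X (x) Y) conj(V), Z> / d_k
   with V the isometric intertwiner from u^k to u^i (x) u^j, so by Cauchy-Schwarz
   |h (a b c)| <= |X| |Y| |Z| / d_k = (d_i d_j / d_k)^(1/2) |a|_2 |b|_2 |c|_2.
   The orthogonality relations make h invariant under cyclic rotation of a b c,
   which gives the two other bounds. *)
Require Import Defs.
From mathcomp Require Import all_boot all_order all_algebra.
From mathcomp Require Import all_classical all_reals.
From mathcomp Require Import complex mxtens ring lra zify.

Set Implicit Arguments.
Unset Strict Implicit.
Unset Printing Implicit Defensive.

Import Order.TTheory GRing.Theory Num.Theory.

Local Open Scope classical_set_scope.
Local Open Scope ring_scope.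
Local Open Scope complex_scope.

(** * Hilbert-Schmidt inner product and Cauchy-Schwarz for complex matrices *)

Section HilbertSchmidt.
Variable C : numClosedFieldType.

Definition barmx m n (M : 'M[C]_(m, n)) : 'M[C]_(m, n) := map_mx Num.conj M.

Lemma barmxK m n (M : 'M[C]_(m, n)) : barmx (barmx M) = M.
Proof. by apply/matrixP=> p q; rewrite !mxE conjCK. Qed.

Lemma barmxM m n p (M : 'M[C]_(m, n)) (N : 'M[C]_(n, p)) :
  barmx (M *m N) = barmx M *m barmx N.
Proof. exact: map_mxM. Qed.

Lemma sum_cauchy_schwarz (I : finType) (x y : I -> C) :
  `|\sum_p x p * Num.conj (y p)| ^+ 2 <=
  (\sum_p x p * Num.conj (x p)) * (\sum_p y p * Num.conj (y p)).
Proof.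
set P := \sum_p x p * Num.conj (x p); set Q := \sum_p y p * Num.conj (y p).
set S := \sum_p x p * Num.conj (y p).
have Pge0 : 0 <= P by apply: sumr_ge0 => p _; exact: mul_conjC_ge0.
have [P0|nP0] := eqVneq P 0.
  have x0 p : x p = 0.
    move/eqP: P0; rewrite psumr_eq0 => [/allP/(_ p (mem_index_enum p))|q _].
      by rewrite mul_conjC_eq0 => /eqP.
    exact: mul_conjC_ge0.
  rewrite P0 mul0r /S big1 ?normr0 ?expr0n // => p _.
  by rewrite x0 mul0r.
have Pgt0 : 0 < P by rewrite lt_def nP0.
have Pr : Num.conj P = P by rewrite conj_Creal // ger0_real.
have SE : Num.conj S = \sum_p y p * Num.conj (x p).
  rewrite rmorph_sum; apply: eq_bigr => p _.
  by rewrite rmorphM /= conjCK mulrC.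
(* The vector [P y - conj(S) x] is [P] times the component of [y] orthogonal to [x]; its squared
   norm is [P * (P * Q - |S|^2)]. *)
have : 0 <= \sum_p (P * y p - Num.conj S * x p)
                   * Num.conj (P * y p - Num.conj S * x p).
  by apply: sumr_ge0 => p _; exact: mul_conjC_ge0.
suff -> : \sum_p (P * y p - Num.conj S * x p)
                   * Num.conj (P * y p - Num.conj S * x p)
   = P * (P * Q - `|S| ^+ 2) by rewrite pmulr_rge0 // subr_ge0.
rewrite normCK.
transitivity (\sum_p (P ^+ 2 * (y p * Num.conj (y p))
   - P * S * (y p * Num.conj (x p)) - P * Num.conj S * (x p * Num.conj (y p))
   + Num.conj S * S * (x p * Num.conj (x p)))).
  apply: eq_bigr => p _; rewrite rmorphB !rmorphM /= conjCK Pr; ring.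
rewrite big_split !sumrB -!mulr_sumr -SE -/P -/Q -/S /=; ring.
Qed.

Definition hsdot m n (X Y : 'M[C]_(m, n)) : C := \tr (X *m (barmx Y)^T).

Lemma hsdotE m n (X Y : 'M[C]_(m, n)) :
  hsdot X Y = \sum_p \sum_q X p q * Num.conj (Y p q).
Proof.
rewrite /hsdot /mxtrace; apply: eq_bigr => p _; rewrite mxE.
by apply: eq_bigr => q _; rewrite !mxE.
Qed.

Lemma hsdot_ge0 m n (X : 'M[C]_(m, n)) : 0 <= hsdot X X.
Proof.
by rewrite hsdotE; do 2!(apply: sumr_ge0 => ? _); exact: mul_conjC_ge0.
Qed.

Lemma hsdot_cauchy_schwarz m n (X Y : 'M[C]_(m, n)) :
  `|hsdot X Y| ^+ 2 <= hsdot X X * hsdot Y Y.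
Proof.
rewrite !hsdotE !pair_bigA /=.
exact: (sum_cauchy_schwarz (fun p => X p.1 p.2) (fun p => Y p.1 p.2)).
Qed.

Lemma hsdot_eq0 m n (X : 'M[C]_(m, n)) : hsdot X X = 0 -> X = 0.
Proof.
rewrite hsdotE pair_bigA /= => /eqP; rewrite psumr_eq0 => [/allP X0|p _].
  apply/matrixP => p q; rewrite mxE.
  by have := X0 (p, q) (mem_index_enum _); rewrite mul_conjC_eq0 => /eqP.
exact: mul_conjC_ge0.
Qed.

Lemma hsdot_tens m n p q (X : 'M[C]_(m, n)) (Y : 'M[C]_(p, q)) :
  hsdot (tensmx X Y) (tensmx X Y) = hsdot X X * hsdot Y Y.
Proof.
rewrite !hsdotE mulr_sum; apply: eq_bigr => a _.
rewrite mulr_sum; apply: eq_bigr => b _.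
rewrite !mxE rmorphM /=; ring.
Qed.

Lemma hsdot_compression m n (V : 'M[C]_(m, n)) (X : 'M[C]_m) (Z : 'M[C]_n) :
  (barmx V)^T *m V = 1%:M ->
  `|hsdot (V^T *m X *m barmx V) Z| ^+ 2 <= hsdot X X * hsdot Z Z.
Proof.
move=> VV; have VV' : V^T *m barmx V = 1%:M.
  by apply: trmx_inj; rewrite trmx_mul trmxK VV trmx1.
(* Moving the compression onto Z yields N, of the same norm as Z. *)
set N := barmx V *m Z *m V^T.
have NE : (barmx N)^T = barmx V *m (barmx Z)^T *m V^T.
  have VT : (barmx V^T)^T = barmx V by apply/matrixP=> p q; rewrite !mxE.
  by rewrite /N !barmxM barmxK !trmx_mul VT mulmxA.
have -> : hsdot Z Z = hsdot N N.
  rewrite /hsdot NE /N.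
  rewrite [RHS]mxtrace_mulC !mulmxA -[_ *m V^T *m barmx V]mulmxA VV' mulmx1.
  rewrite -[RHS]/(\tr (_ *m V^T)) [RHS]mxtrace_mulC !mulmxA VV' mul1mx.
  by rewrite mxtrace_mulC.
have -> : hsdot (V^T *m X *m barmx V) Z = hsdot X N.
  by rewrite /hsdot NE -!mulmxA mxtrace_mulC !mulmxA.
exact: hsdot_cauchy_schwarz.
Qed.

End HilbertSchmidt.

(** * Matrices over a C*-algebra: adjoints, transposes, tensor products and blocks *)

Section StarMatrices.
Variables (R : realType) (A : cstarAlgType R).
Local Notation C := R[i].
Implicit Types x y : A.

Lemma star1 : star 1 = 1 :> A.
Proof.
have := starM 1 (star 1 : A).
by rewrite mul1r !starK mul1r => <-.
Qed.

Lemma star0 : star 0 = 0 :> A.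
Proof. by rewrite -(scale0r (0 : A)) starZ rmorph0 !scale0r. Qed.

Lemma star_sum (I : Type) (r : seq I) (P : pred I) (f : I -> A) :
  star (\sum_(p <- r | P p) f p) = \sum_(p <- r | P p) star (f p).
Proof. exact: (big_morph _ (@starD _ A) star0). Qed.

Lemma cmxE m n (M : 'M[C]_(m, n)) p q : cmx A M p q = (M p q)%:A.
Proof. by rewrite !mxE. Qed.

Lemma cmxM m n p (M : 'M[C]_(m, n)) (N : 'M[C]_(n, p)) :
  cmx A (M *m N) = cmx A M *m cmx A N.
Proof. exact: map_mxM. Qed.

Lemma cmx1 n : cmx A 1%:M = 1%:M :> 'M_n.
Proof. exact: map_mx1. Qed.

Lemma cmx_mulE m n k (M : 'M[C]_(m, n)) (v : 'M[A]_(n, k)) p q :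
  (cmx A M *m v) p q = \sum_r M p r *: v r q.
Proof. by rewrite mxE; apply: eq_bigr => r _; rewrite cmxE mulr_algl. Qed.

Lemma mul_cmxE m n k (v : 'M[A]_(m, n)) (M : 'M[C]_(n, k)) p q :
  (v *m cmx A M) p q = \sum_r M r q *: v p r.
Proof. by rewrite mxE; apply: eq_bigr => r _; rewrite cmxE mulr_algr. Qed.

(** Over a noncommutative algebra transposition does not reverse products in general; here it does
    because the entries of [cmx A M] are central. *)
Lemma tr_cmx_mul m n k (M : 'M[C]_(m, n)) (v : 'M[A]_(n, k)) :
  (cmx A M *m v)^T = v^T *m cmx A M^T.
Proof.
apply/matrixP => p q; rewrite mxE cmx_mulE mul_cmxE.
by apply: eq_bigr => r _; rewrite !mxE.
Qed.

Lemma tr_mul_cmx m n k (v : 'M[A]_(m, n)) (M : 'M[C]_(n, k)) :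
  (v *m cmx A M)^T = cmx A M^T *m v^T.
Proof. by rewrite -[RHS]trmxK tr_cmx_mul !trmxK. Qed.

Lemma mxstarK m n (v : 'M[A]_(m, n)) : mxstar (mxstar v) = v.
Proof. by apply/matrixP => p q; rewrite !mxE starK. Qed.

Lemma mxstar_cmx_mul m n k (M : 'M[C]_(m, n)) (v : 'M[A]_(n, k)) :
  mxstar (cmx A M *m v) = cmx A (barmx M) *m mxstar v.
Proof.
apply/matrixP => p q; rewrite mxE !cmx_mulE star_sum.
by apply: eq_bigr => r _; rewrite starZ !mxE.
Qed.

Lemma mxstar_mul_cmx m n k (v : 'M[A]_(m, n)) (M : 'M[C]_(n, k)) :
  mxstar (v *m cmx A M) = mxstar v *m cmx A (barmx M).
Proof.
apply/matrixP => p q; rewrite mxE !mul_cmxE star_sum.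
by apply: eq_bigr => r _; rewrite starZ !mxE.
Qed.

Lemma cadjE m n (M : 'M[C]_(m, n)) : cadj M = (barmx M)^T.
Proof. by []. Qed.

Lemma cadjK m n (M : 'M[C]_(m, n)) : cadj (cadj M) = M.
Proof. by apply/matrixP=> p q; rewrite !mxE conjCK. Qed.

Lemma isometry_tr m n (V : 'M[C]_(m, n)) :
  cadj V *m V = 1%:M -> V^T *m barmx V = 1%:M.
Proof. by move=> VV; apply: trmx_inj; rewrite trmx_mul trmxK VV trmx1. Qed.

(** Unitarity of the entrywise adjoint [mxstar v], with the double star simplified. Over a
    noncommutative algebra it is not implied by unitarity of [v]; it is what keeps modular weights
    out of the orthogonality relations. *)
Definition conj_unitary n (v : 'M[A]_n) : Prop :=
  mxstar v *m v^T = 1%:M /\ v^T *m mxstar v = 1%:M.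

(** The two intertwining relations say that the range of [V] reduces [t], with corner [v]. Starring
    and transposing them shows that [mxstar v] and [v^T] are the corners of [mxstar t] and [t^T]
    along [barmx V], and corners along a reducing subspace multiply. *)
Lemma conj_unitary_sub m n (V : 'M[C]_(m, n)) (t : 'M[A]_m) (v : 'M[A]_n) :
  cadj V *m V = 1%:M ->
  t *m cmx A V = cmx A V *m v -> cmx A (cadj V) *m t = v *m cmx A (cadj V) ->
  conj_unitary t -> conj_unitary v.
Proof.
move=> VV tV Vt [tt1 tt2].
have VV' : cmx A V^T *m cmx A (barmx V) = 1%:M.
  by rewrite -cmxM isometry_tr ?cmx1.
have E1 : cmx A V^T *m t^T = v^T *m cmx A V^T.
  by rewrite -tr_mul_cmx tV tr_cmx_mul.
have E2 : t^T *m cmx A (barmx V) = cmx A (barmx V) *m v^T.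
  by rewrite -[barmx V]trmxK -tr_cmx_mul Vt tr_mul_cmx.
have E3 : mxstar t *m cmx A (barmx V) = cmx A (barmx V) *m mxstar v.
  by rewrite -mxstar_mul_cmx tV mxstar_cmx_mul.
have E4 : cmx A V^T *m mxstar t = mxstar v *m cmx A V^T.
  have -> : V^T = barmx (cadj V) by apply/matrixP=> p q; rewrite !mxE conjCK.
  by rewrite -mxstar_cmx_mul Vt mxstar_mul_cmx.
split.
  rewrite -[mxstar v]mulmx1 -VV' mulmxA -E4 -!mulmxA -E2.
  by rewrite (mulmxA (mxstar t)) tt1 mul1mx VV'.
rewrite -[v^T]mulmx1 -VV' mulmxA -E1 -!mulmxA -E3.
by rewrite (mulmxA t^T) tt2 mul1mx VV'.
Qed.

Lemma sum_mxtens_index m n (f : 'I_(m * n) -> A) :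
  \sum_p f p = \sum_(a < m) \sum_(b < n) f (mxtens_index (a, b)).
Proof.
rewrite pair_bigA /= (reindex (@mxtens_index m n)) /=; last first.
  exists (@mxtens_unindex m n) => p _; first exact: mxtens_indexK.
  exact: mxtens_unindexK.
by apply: eq_bigr => -[].
Qed.

Lemma mxtens_index_eq m n (a a' : 'I_m) (b b' : 'I_n) :
  (mxtens_index (a, b) == mxtens_index (a', b')) = (a == a') && (b == b').
Proof. by rewrite (can_eq (@mxtens_indexK m n)) xpair_eqE. Qed.

(** Since [star] reverses products, the two factors from the same matrix meet in the middle and
    collapse first: those of [v] in the first identity, those of [w] in the second. The resulting
    scalar lets the outer pair collapse as well. *)
Lemma conj_unitary_tens m n (v : 'M[A]_m) (w : 'M[A]_n) :
  conj_unitary v -> conj_unitary w -> conj_unitary (tensmx v w).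
Proof.
have entry k (x y : 'M[A]_k) p q : x *m y = 1%:M ->
    \sum_r x p r * y r q = (p == q)%:R.
  by move/matrixP/(_ p q); rewrite !mxE.
move=> [v1 v2] [w1 w2]; split; apply/matrixP => p q;
  case: (mxtens_indexP p) => a b; case: (mxtens_indexP q) => c d;
  rewrite !mxE sum_mxtens_index mxtens_index_eq.
- rewrite exchange_big /=.
  transitivity (\sum_f star (w b f) * (\sum_e star (v a e) * v c e) * w d f).
    apply: eq_bigr => f _; rewrite mulr_sumr mulr_suml; apply: eq_bigr => e _.
    by rewrite !mxE !mxtens_indexK /= starM !mulrA.
  have -> : \sum_e star (v a e) * v c e = (a == c)%:R.
    by rewrite -(entry _ _ _ _ _ v1); apply: eq_bigr => e _; rewrite !mxE.
  rewrite andbC -mulnb natrM -(entry _ _ _ _ _ w1) mulr_suml.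
  apply: eq_bigr => f _; rewrite !mxE -!mulrA; congr (_ * _).
  by case: (a == c); rewrite ?mul1r ?mulr1 ?mul0r ?mulr0.
- transitivity (\sum_e v e a * (\sum_f w f b * star (w f d)) * star (v e c)).
    apply: eq_bigr => e _; rewrite mulr_sumr mulr_suml; apply: eq_bigr => f _.
    by rewrite !mxE !mxtens_indexK /= starM !mulrA.
  have -> : \sum_e w e b * star (w e d) = (b == d)%:R.
    by rewrite -(entry _ _ _ _ _ w2); apply: eq_bigr => e _; rewrite !mxE.
  rewrite -mulnb natrM -(entry _ _ _ _ _ v2) mulr_suml.
  apply: eq_bigr => f _; rewrite !mxE -!mulrA; congr (_ * _).
  by case: (b == d); rewrite ?mul1r ?mulr1 ?mul0r ?mulr0.
Qed.

(** Cutting the unitary equivalence into block columns [V l] gives one isometric intertwiner per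
    summand. This is the form in which the fusion rules are used. *)
Lemma equiv_rep_mxdiag n (t : 'M[A]_n) k (p_ : 'I_k -> nat)
    (D : forall l, 'M[A]_(p_ l)) :
  equiv_rep t (mxdiag D) ->
  exists V : forall l, 'M[C]_(n, p_ l),
    [/\ forall l, cadj (V l) *m V l = 1%:M,
        forall l, t *m cmx A (V l) = cmx A (V l) *m D l,
        forall l, cmx A (cadj (V l)) *m t = D l *m cmx A (cadj (V l))
      & t = \sum_l cmx A (V l) *m D l *m cmx A (cadj (V l))].
Proof.
move=> [M [MM1 MM2 tM]].
pose V l := submxrow M l.
have ME : M = mxrow V by rewrite submxrowK.
have MadjE : cadj M = mxcol (fun l => cadj (V l)).
  by rewrite cadjE ME; apply/matrixP => p q; rewrite !mxE.
have cME : cmx A M = mxrow (fun l => cmx A (V l)).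
  by rewrite ME; apply/matrixP => p q; rewrite !mxE.
have cMadjE : cmx A (cadj M) = mxcol (fun l => cmx A (cadj (V l))).
  by rewrite MadjE; apply/matrixP => p q; rewrite !mxE.
have Mt : cmx A (cadj M) *m t = mxdiag D *m cmx A (cadj M).
  rewrite -[LHS]mulmx1 -cmx1 -MM1 cmxM mulmxA -(mulmxA _ t) tM mulmxA.
  by rewrite -cmxM MM2 cmx1 mul1mx.
exists V; split=> [l|l|l|].
- move: MM2; rewrite MadjE ME mul_mxcol_mxrow -(@mxdiagZ _ _ p_).
  move/(congr1 (fun N => submxblock N l l)).
  by rewrite !mxblockK eqxx conform_mx_id.
- by move: tM; rewrite cME mul_mxrow mul_mxrow_mxdiag => /eq_mxrowP.
- by move: Mt; rewrite cMadjE mxcol_mul mul_mxdiag_mxcol => /eq_mxcolP.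
- rewrite -[LHS]mulmx1 -cmx1 -MM1 cmxM mulmxA tM cME cMadjE.
  by rewrite mul_mxrow_mxdiag mul_mxrow_mxcol.
Qed.

End StarMatrices.

(** * Schur's lemma for unitary matrices over a C*-algebra *)

Section Schur.
Variables (R : realType) (A : cstarAlgType R).
Local Notation C := R[i].

(** The adjoint of the relation intertwines the inverses of [v] and [w]; multiplying by [w] on the
    left and [v] on the right finishes. *)
Lemma intertwiner_adj m n (v : 'M[A]_m) (w : 'M[A]_n) (M : 'M[C]_(m, n)) :
  unitary_mx v -> unitary_mx w ->
  v *m cmx A M = cmx A M *m w -> w *m cmx A (cadj M) = cmx A (cadj M) *m v.
Proof.
move=> [_ v2] [w1 _] vM.
have Mv : cmx A (cadj M) *m (mxstar v)^T = (mxstar w)^T *m cmx A (cadj M).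
  by rewrite cadjE -tr_mul_cmx -mxstar_mul_cmx vM mxstar_cmx_mul tr_cmx_mul.
rewrite -[LHS]mulmx1 -v2 mulmxA -[w *m _ *m _]mulmxA Mv mulmxA.
by rewrite w1 mul1mx.
Qed.

(** Both [M *m cadj M] and [cadj M *m M] are self-intertwiners, hence scalars. For [M != 0] the
    scalars agree and are positive, so dividing [M] by their square root gives a unitary
    equivalence. *)
Lemma schur_inequiv m n (v : 'M[A]_m) (w : 'M[A]_n) (M : 'M[C]_(m, n)) :
  unitary_mx v -> unitary_mx w -> irreducible_rep v -> irreducible_rep w ->
  ~ equiv_rep v w -> v *m cmx A M = cmx A M *m w -> M = 0.
Proof.
move=> vu wu vi wi nvw vM; have [//|M0] := eqVneq M 0; case: nvw.
have wM := intertwiner_adj vu wu vM.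
have [l MMl] : exists l, M *m cadj M = l%:M.
  by apply: vi; rewrite cmxM mulmxA vM -mulmxA wM mulmxA.
have [l' MMl'] : exists l, cadj M *m M = l%:M.
  by apply: wi; rewrite cmxM mulmxA wM -mulmxA vM mulmxA.
have ll' : l = l'.
  have := mulmxA M (cadj M) M; rewrite MMl MMl' mul_scalar_mx mul_mx_scalar.
  move/esym/eqP; rewrite -subr_eq0 -scalerBl scaler_eq0 (negPf M0) orbF.
  by rewrite subr_eq0 => /eqP.
have trl : hsdot M M = l *+ m by rewrite /hsdot -cadjE MMl mxtrace_scalar.
have l_gt0 : 0 < l.
  have hgt0 : 0 < hsdot M M.
    by rewrite lt_def hsdot_ge0 andbT; apply: contra_neq M0 => /hsdot_eq0.
  (* If [m = 0] the trace is empty, so [hgt0] reads [0 < 0]. *)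
  by move: hgt0; rewrite trl; case: (posnP m) => [->|m0];
     rewrite ?mulr0n ?ltxx // pmulrn_lgt0.
pose s : C := (sqrtC l)^-1.
have ssl : s * Num.conj s * l = 1.
  have sr : Num.conj s = s.
    by rewrite conj_Creal // rpredV ger0_real // sqrtC_ge0 ltW.
  by rewrite sr /s -invfM -expr2 sqrtCK mulVf // gt_eqF.
have adjs : cadj (s *: M) = Num.conj s *: cadj M.
  by apply/matrixP => p q; rewrite !mxE rmorphM.
exists (s *: M); split.
- by rewrite adjs -scalemxAl -scalemxAr scalerA MMl scale_scalar_mx ssl.
- rewrite adjs -scalemxAl -scalemxAr scalerA MMl' -ll' scale_scalar_mx.
  by rewrite [_^* * _]mulrC ssl.
- apply/matrixP => p q; rewrite mul_cmxE cmx_mulE.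
  move/matrixP/(_ p q): vM; rewrite mul_cmxE cmx_mulE => vMpq.
  transitivity (s *: \sum_r M r q *: v p r).
    by rewrite scaler_sumr; apply: eq_bigr => r _; rewrite scalerA !mxE.
  by rewrite vMpq scaler_sumr; apply: eq_bigr => r _; rewrite scalerA !mxE.
Qed.

End Schur.

(** * Orthogonality relations for the Haar state *)

Section Haar.
Variables (R : realType) (A T : cstarAlgType R).
Variables (iota1 iota2 Delta : {lrmorphism A -> T}) (h : {scalar A}).
Hypothesis tensT : is_min_tensor iota1 iota2.
Hypothesis Delta_star : star_morphism Delta.
Hypothesis haar_h : is_haar iota1 iota2 Delta h.
Local Notation C := R[i].

(** Invariance of [h] under [id (x) h], applied to the products [v i j * star (w k l)], reads
    [v G w^* = G]; multiplying by [w] on the right gives the claim. *)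
Lemma haar_intertwiner_right m n (v : 'M[A]_m) (w : 'M[A]_n) j l :
  unitary_rep iota1 iota2 Delta v -> unitary_rep iota1 iota2 Delta w ->
  let G := \matrix_(a, b) h (v a j * star (w b l)) in
  v *m cmx A G = cmx A G *m w.
Proof.
move=> [[_ _] vD] [[_ w2] wD] G.
have [E sE] := mt_slice2 tensT (haar_state haar_h).
have vGw : v *m cmx A G *m (mxstar w)^T = cmx A G.
  apply/matrixP => i k; rewrite cmxE [G i k]mxE.
  rewrite -(haar_right haar_h sE (v i j * star (w k l))).
  have -> : Delta (v i j * star (w k l)) = \sum_b \sum_a
      iota1 (v i a * star (w k b)) * iota2 (v a j * star (w b l)).
    rewrite rmorphM /= Delta_star vD wD star_sum mulr_sumr.
    apply: eq_bigr => b _; rewrite mulr_suml; apply: eq_bigr => a _.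
    rewrite starM -!(mt_star1 tensT) -!(mt_star2 tensT) !rmorphM /=.
    rewrite -!mulrA; congr (_ * _).
    by rewrite -(rmorphM iota2) (mt_comm tensT) rmorphM mulrA.
  rewrite mxE linear_sum; apply: eq_bigr => b _; rewrite linear_sum.
  rewrite mul_cmxE mulr_suml; apply: eq_bigr => a _.
  by rewrite (proj2 sE) !mxE scalerAl.
by rewrite -[in RHS]vGw -mulmxA w2 mulmx1.
Qed.

(** The mirror image: slicing with [h (x) id] gives [v^* G w = G], to be multiplied by [v] on the
    left. *)
Lemma haar_intertwiner_left m n (v : 'M[A]_m) (w : 'M[A]_n) i k :
  unitary_rep iota1 iota2 Delta v -> unitary_rep iota1 iota2 Delta w ->
  let G := \matrix_(a, b) h (star (v i a) * w k b) in
  v *m cmx A G = cmx A G *m w.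
Proof.
move=> [[v1 _] vD] [[_ _] wD] G.
have [E sE] := mt_slice1 tensT (haar_state haar_h).
have vGw : (mxstar v)^T *m cmx A G *m w = cmx A G.
  apply/matrixP => j l; rewrite cmxE [G j l]mxE.
  rewrite -(haar_left haar_h sE (star (v i j) * w k l)).
  have -> : Delta (star (v i j) * w k l) = \sum_b \sum_a
      iota1 (star (v i a) * w k b) * iota2 (star (v a j) * w b l).
    rewrite rmorphM /= Delta_star vD wD star_sum mulr_sumr.
    apply: eq_bigr => b _; rewrite mulr_suml; apply: eq_bigr => a _.
    rewrite starM -!(mt_star1 tensT) -!(mt_star2 tensT) !rmorphM /=.
    rewrite -(mt_comm tensT) -!mulrA; congr (_ * _).
    by rewrite !mulrA -(mt_comm tensT).
  rewrite mxE linear_sum; apply: eq_bigr => b _; rewrite linear_sum.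
  rewrite mul_cmxE mulr_suml; apply: eq_bigr => a _.
  by rewrite (proj2 sE) !mxE scalerAl.
by rewrite -[in LHS]vGw -!mulmxA mulmxA v1 mul1mx.
Qed.

(** Irreducibility makes the averaged matrix a scalar, whose value is read off its trace. That trace
    is [h] of an entry of [v^T *m mxstar v], which [conj_unitary] evaluates. *)
Lemma haar_orth_right n (v : 'M[A]_n.+1) p q a b :
  unitary_rep iota1 iota2 Delta v -> irreducible_rep v -> conj_unitary v ->
  h (v p a * star (v q b)) = ((p == q) && (a == b))%:R / n.+1%:R.
Proof.
move=> vr vi [_ vc].
have [l Gl] := vi _ (haar_intertwiner_right a b vr vr).
have trG : l * n.+1%:R = (a == b)%:R.
  rewrite mulr_natr -mxtrace_scalar -Gl /mxtrace.
  transitivity (h (\sum_p v p a * star (v p b))).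
    by rewrite linear_sum; apply: eq_bigr => r _; rewrite mxE.
  move/matrixP/(_ a b): vc; rewrite !mxE => vcab.
  transitivity (h ((a == b)%:R)).
    by congr (h _); rewrite -vcab; apply: eq_bigr => r _; rewrite !mxE.
  by case: (a == b); rewrite ?linear0 // (proj2 (haar_state haar_h)).
move/matrixP/(_ p q): Gl; rewrite !mxE => ->.
have n0 : n.+1%:R != 0 :> C by rewrite pnatr_eq0.
by rewrite -mulnb natrM -trG mulrA mulfK // mulr_natl.
Qed.

(** Here the trace is [h] of an entry of [mxstar v *m v^T], the other half of [conj_unitary]. *)
Lemma haar_orth_left n (v : 'M[A]_n.+1) p q a b :
  unitary_rep iota1 iota2 Delta v -> irreducible_rep v -> conj_unitary v ->
  h (star (v p a) * v q b) = ((p == q) && (a == b))%:R / n.+1%:R.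
Proof.
move=> vr vi [vc _].
have [l Gl] := vi _ (haar_intertwiner_left p q vr vr).
have trG : l * n.+1%:R = (p == q)%:R.
  rewrite mulr_natr -mxtrace_scalar -Gl /mxtrace.
  transitivity (h (\sum_r star (v p r) * v q r)).
    by rewrite linear_sum; apply: eq_bigr => r _; rewrite mxE.
  move/matrixP/(_ p q): vc; rewrite !mxE => vcpq.
  transitivity (h ((p == q)%:R)).
    by congr (h _); rewrite -vcpq; apply: eq_bigr => r _; rewrite !mxE.
  by case: (p == q); rewrite ?linear0 // (proj2 (haar_state haar_h)).
move/matrixP/(_ a b): Gl; rewrite !mxE => ->.
have n0 : n.+1%:R != 0 :> C by rewrite pnatr_eq0.
by rewrite andbC -mulnb natrM -trG mulrA mulfK // mulr_natl.
Qed.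

Lemma haar_inequiv_right m n (v : 'M[A]_m) (w : 'M[A]_n) p q a b :
  unitary_rep iota1 iota2 Delta v -> unitary_rep iota1 iota2 Delta w ->
  irreducible_rep v -> irreducible_rep w -> ~ equiv_rep v w ->
  h (v p a * star (w q b)) = 0.
Proof.
move=> vr wr vi wi nvw.
have := schur_inequiv (proj1 vr) (proj1 wr) vi wi nvw
  (haar_intertwiner_right a b vr wr).
by move/matrixP/(_ p q); rewrite !mxE.
Qed.

Lemma haar_inequiv_left m n (v : 'M[A]_m) (w : 'M[A]_n) p q a b :
  unitary_rep iota1 iota2 Delta v -> unitary_rep iota1 iota2 Delta w ->
  irreducible_rep v -> irreducible_rep w -> ~ equiv_rep v w ->
  h (star (v p a) * w q b) = 0.
Proof.
move=> vr wr vi wi nvw.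
have := schur_inequiv (proj1 vr) (proj1 wr) vi wi nvw
  (haar_intertwiner_left p q vr wr).
by move/matrixP/(_ a b); rewrite !mxE.
Qed.

End Haar.

(** * Calculus of matrix coefficients with a given coefficient matrix *)

Section Coefficients.
Variables (R : realType) (A : cstarAlgType R).
Local Notation C := R[i].

(** This is the trace of [X^T] times [v]; the elements of [Vspace u k] are those with [v = u k]. *)
Definition mcoef n (X : 'M[C]_n) (v : 'M[A]_n) : A :=
  \sum_p \sum_q X p q *: v p q.

Lemma star_mcoef n (X : 'M[C]_n) (v : 'M[A]_n) :
  star (mcoef X v) = \sum_p \sum_q Num.conj (X p q) *: star (v p q).
Proof.
rewrite star_sum; apply: eq_bigr => p _; rewrite star_sum.
by apply: eq_bigr => q _; rewrite starZ.
Qed.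

Lemma mcoef_sum n (X : 'M[C]_n) (I : finType) (v : I -> 'M[A]_n) :
  mcoef X (\sum_l v l) = \sum_l mcoef X (v l).
Proof.
rewrite /mcoef [RHS]exchange_big /=; apply: eq_bigr => p _.
rewrite [RHS]exchange_big /=; apply: eq_bigr => q _.
by rewrite summxE scaler_sumr.
Qed.

(** Cyclicity of the trace moves [V] and its adjoint onto [X^T]; transposing back yields the
    compressed coefficient matrix. *)
Lemma mcoef_conj m n (X : 'M[C]_m) (V : 'M[C]_(m, n)) (v : 'M[A]_n) :
  mcoef X (cmx A V *m v *m cmx A (cadj V)) = mcoef (V^T *m X *m barmx V) v.
Proof.
transitivity (\sum_p \sum_q \sum_r \sum_s
    (X p q * (V p r * Num.conj (V q s))) *: v r s).
  apply: eq_bigr => p _; apply: eq_bigr => q _.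
  rewrite mul_cmxE exchange_big scaler_sumr /=; apply: eq_bigr => s _.
  rewrite cmx_mulE !scaler_sumr; apply: eq_bigr => r _.
  by rewrite !scalerA !mxE -mulrA [V p r * _]mulrC.
transitivity (\sum_r \sum_s \sum_q \sum_p
    (X p q * (V p r * Num.conj (V q s))) *: v r s).
  under eq_bigr do rewrite exchange_big /=.
  rewrite exchange_big /=; apply: eq_bigr => r _.
  under eq_bigr do rewrite exchange_big /=.
  by rewrite exchange_big /=; apply: eq_bigr => s _; rewrite exchange_big.
apply: eq_bigr => r _; apply: eq_bigr => s _.
rewrite !mxE scaler_suml; apply: eq_bigr => q _.
rewrite !mxE mulr_suml scaler_suml; apply: eq_bigr => p _.
by rewrite !mxE mulrA [X p q * _]mulrC.
Qed.

Lemma mcoef_mul m n (X : 'M[C]_m) (Y : 'M[C]_n) (v : 'M[A]_m) (w : 'M[A]_n) :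
  mcoef X v * mcoef Y w = mcoef (tensmx X Y) (tensmx v w).
Proof.
rewrite /mcoef mulr_sum; apply: eq_bigr => p _.
rewrite mulr_sum; apply: eq_bigr => q _.
by rewrite !mxE -scalerAl -scalerAr scalerA.
Qed.

Lemma mul_star_mcoef m n (X : 'M[C]_m) (Y : 'M[C]_n)
    (v : 'M[A]_m) (w : 'M[A]_n) :
  mcoef X v * star (mcoef Y w) = \sum_p \sum_q \sum_r \sum_s
    (X p r * Num.conj (Y q s)) *: (v p r * star (w q s)).
Proof.
rewrite star_mcoef mulr_suml; apply: eq_bigr => p _.
rewrite mulr_sumr; apply: eq_bigr => q _.
rewrite mulr_suml; apply: eq_bigr => r _.
rewrite mulr_sumr; apply: eq_bigr => s _.
by rewrite -scalerAl -scalerAr scalerA.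
Qed.

Lemma star_mcoef_mul m n (X : 'M[C]_m) (Y : 'M[C]_n)
    (v : 'M[A]_m) (w : 'M[A]_n) :
  star (mcoef Y w) * mcoef X v = \sum_p \sum_q \sum_r \sum_s
    (X p r * Num.conj (Y q s)) *: (star (w q s) * v p r).
Proof.
rewrite star_mcoef mulr_sumr; apply: eq_bigr => p _.
rewrite mulr_suml; apply: eq_bigr => q _.
rewrite mulr_sumr; apply: eq_bigr => r _.
rewrite mulr_suml; apply: eq_bigr => s _.
by rewrite -scalerAl -scalerAr scalerA mulrC.
Qed.

Lemma sum_diag n (X Y : 'M[C]_n) (d : C) :
  \sum_p \sum_q \sum_r \sum_s
    (X p r * Num.conj (Y q s)) * (((p == q) && (r == s))%:R / d) =
  hsdot X Y / d.
Proof.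
rewrite hsdotE mulr_suml; apply: eq_bigr => p _.
rewrite (bigD1 p) //= [X in _ + X]big1 ?addr0 => [|q /negPf qp]; last first.
  rewrite big1 // => r _; rewrite big1 // => s _.
  by rewrite eq_sym qp mul0r mulr0.
rewrite mulr_suml; apply: eq_bigr => r _; rewrite (bigD1 r) //= !eqxx.
rewrite big1 ?addr0 => [|s /negPf sr]; first by rewrite mul1r.
by rewrite eq_sym sr andbF mul0r mulr0.
Qed.

End Coefficients.

(** * Triple products of coefficients of the irreducible representations *)

Section IrrepSystem.
Variables (R : realType) (F : 'M[R[i]]_2) (A T : cstarAlgType R).
Variables (iota1 iota2 Delta : {lrmorphism A -> T}) (w : 'M[A]_2).
Variables (h : {scalar A}) (u : forall k : nat, 'M[A]_k.+1).
Hypothesis F_unit : F \in unitmx.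
Hypothesis F_unitary : cadj F *m F = 1%:M.
Hypothesis OF : is_OFplus F iota1 iota2 Delta w.
Hypothesis haar_h : is_haar iota1 iota2 Delta h.
Hypothesis irr_u : is_irrep_system iota1 iota2 Delta w u.
Local Notation C := R[i].

(* The Kac property: the only place where the unitarity of F is used. *)
Lemma conj_unitary_fundamental : conj_unitary w.
Proof.
have [[wu wF] _ _] := of_univ OF.
have invF : invmx F = cadj F.
  by rewrite -[RHS]mulmx1 -(mulmxV F_unit) mulmxA F_unitary mul1mx.
have cF : cmx A F *m cmx A (cadj F) = 1%:M.
  by rewrite -cmxM -invF mulmxV // cmx1.
have cF' : cmx A (cadj F) *m cmx A F = 1%:M by rewrite -cmxM F_unitary cmx1.
apply: (@conj_unitary_sub _ _ _ _ (cadj F) (mxstar w)).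
- by rewrite cadjK -invF mulmxV.
- by rewrite [in RHS]wF invF !mulmxA cF' mul1mx.
- by rewrite cadjK [in RHS]wF invF -!mulmxA cF' mulmx1.
- by split; rewrite mxstarK; [exact: wu.1|exact: wu.2].
Qed.

(** From degree 2 on, each irreducible representation is a summand of its predecessor tensored with
    the fundamental one, so the property climbs by [conj_unitary_tens] and [conj_unitary_sub]. *)
Lemma conj_unitary_irrep k : conj_unitary (u k).
Proof.
case: k => [|k].
  have star1mx : mxstar (1%:M : 'M[A]_1) = 1%:M.
    by apply/matrixP => p q; rewrite !mxE !ord1 eqxx star1.
  by rewrite (ir_0 irr_u); split; rewrite star1mx trmx1 mulmx1.
elim: k => [|k IHk].
  by rewrite (ir_1 irr_u); exact: conj_unitary_fundamental.
have [V [VV tV Vt _]] := equiv_rep_mxdiag (ir_fusion irr_u k.+1 1).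
(* The summands are numbered from 0; number 1 has degree |(k+1) - 1| + 2 = k + 2. *)
have m1 : (1 < (minn k.+1 1).+1)%N by lia.
have := conj_unitary_sub (VV (Ordinal m1)) (tV _) (Vt _).
have -> : (`|k.+1%:Z - 1%:Z| + (Ordinal m1).*2 = k.+2)%N by rewrite /=; lia.
apply; apply: conj_unitary_tens => //.
by rewrite (ir_1 irr_u); exact: conj_unitary_fundamental.
Qed.

Lemma haar_mcoef_right k (X Z : 'M[C]_k.+1) :
  h (mcoef X (u k) * star (mcoef Z (u k))) = hsdot X Z / k.+1%:R.
Proof.
rewrite mul_star_mcoef -sum_diag.
do 4!(rewrite linear_sum; apply: eq_bigr => ? _).
rewrite linearZ /=; congr (_ * _); apply: haar_orth_right => //.
- exact: of_tensor OF.
- exact: of_delta_star OF.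
- exact: haar_h.
- exact: ir_rep irr_u _.
- exact: ir_irr irr_u _.
- exact: conj_unitary_irrep.
Qed.

Lemma haar_mcoef_left k (X Z : 'M[C]_k.+1) :
  h (star (mcoef Z (u k)) * mcoef X (u k)) = hsdot X Z / k.+1%:R.
Proof.
rewrite star_mcoef_mul -sum_diag.
do 4!(rewrite linear_sum; apply: eq_bigr => ? _).
rewrite linearZ /= [X in X && _]eq_sym [X in _ && X]eq_sym.
congr (_ * _); apply: haar_orth_left => //.
- exact: of_tensor OF.
- exact: of_delta_star OF.
- exact: haar_h.
- exact: ir_rep irr_u _.
- exact: ir_irr irr_u _.
- exact: conj_unitary_irrep.
Qed.

Lemma haar_mcoef_right0 k l (X : 'M[C]_k.+1) (Z : 'M[C]_l.+1) : k != l ->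
  h (mcoef X (u k) * star (mcoef Z (u l))) = 0.
Proof.
move=> kl; rewrite mul_star_mcoef.
do 4!(rewrite linear_sum big1 // => ? _).
rewrite linearZ /=; apply/eqP; rewrite mulf_eq0; apply/orP; right; apply/eqP.
apply: (haar_inequiv_right (of_tensor OF) (of_delta_star OF) haar_h).
- exact: ir_rep irr_u _.
- exact: ir_rep irr_u _.
- exact: ir_irr irr_u _.
- exact: ir_irr irr_u _.
- by move/(ir_inj irr_u); apply/eqP.
Qed.

Lemma haar_mcoef_left0 k l (X : 'M[C]_k.+1) (Z : 'M[C]_l.+1) : k != l ->
  h (star (mcoef Z (u l)) * mcoef X (u k)) = 0.
Proof.
move=> kl; rewrite star_mcoef_mul.
do 4!(rewrite linear_sum big1 // => ? _).
rewrite linearZ /=; apply/eqP; rewrite mulf_eq0; apply/orP; right; apply/eqP.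
apply: (haar_inequiv_left (of_tensor OF) (of_delta_star OF) haar_h).
- exact: ir_rep irr_u _.
- exact: ir_rep irr_u _.
- exact: ir_irr irr_u _.
- exact: ir_irr irr_u _.
- by move/(ir_inj irr_u) => lk; rewrite lk eqxx in kl.
Qed.

(** The trace property on pairs of coefficients: the left and right orthogonality relations give the
    same values. *)
Lemma haar_mcoefC k l (X : 'M[C]_k.+1) (Z : 'M[C]_l.+1) :
  h (mcoef X (u k) * star (mcoef Z (u l))) =
  h (star (mcoef Z (u l)) * mcoef X (u k)).
Proof.
have [kl|kl] := eqVneq k l; last by rewrite haar_mcoef_right0 ?haar_mcoef_left0.
by subst l; rewrite haar_mcoef_right haar_mcoef_left.
Qed.

Lemma mcoef_fusion i j :
  exists V : forall m : 'I_(minn i j).+1,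
      'M[C]_(i.+1 * j.+1, (`|i%:Z - j%:Z| + m.*2)%N.+1),
    (forall m, cadj (V m) *m V m = 1%:M) /\
    forall X Y, mcoef X (u i) * mcoef Y (u j) =
      \sum_m mcoef ((V m)^T *m tensmx X Y *m barmx (V m))
                   (u (`|i%:Z - j%:Z| + m.*2)%N).
Proof.
have [V [VV _ _ tE]] := equiv_rep_mxdiag (ir_fusion irr_u i j).
exists V; split=> // X Y; rewrite mcoef_mul tE mcoef_sum.
by apply: eq_bigr => m _; rewrite mcoef_conj.
Qed.

(** Fusion expands the product of two coefficients into single coefficients, to which [haar_mcoefC]
    applies term by term. This yields the cyclic rotations in the theorem. *)
Lemma haar_mulC i j k (X : 'M[C]_i.+1) (Y : 'M[C]_j.+1) (Z : 'M[C]_k.+1) :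
  h (mcoef X (u i) * mcoef Y (u j) * star (mcoef Z (u k))) =
  h (star (mcoef Z (u k)) * (mcoef X (u i) * mcoef Y (u j))).
Proof.
have [V [_ XY]] := mcoef_fusion i j.
rewrite XY mulr_suml mulr_sumr !linear_sum.
by apply: eq_bigr => m _; rewrite haar_mcoefC.
Qed.

(** Orthogonality keeps only the summand of degree [k] in the fusion expansion, and compressing to
    it does not increase the Hilbert-Schmidt norm. The equation for [k] is a hypothesis so that
    substitution aligns the matrix sizes without casts. *)
Lemma haar_triple_le i j (m : 'I_(minn i j).+1) k
    (X : 'M[C]_i.+1) (Y : 'M[C]_j.+1) (Z : 'M[C]_k.+1) :
  k = (`|i%:Z - j%:Z| + m.*2)%N ->
  `|h (mcoef X (u i) * mcoef Y (u j) * star (mcoef Z (u k)))| ^+ 2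
    <= hsdot X X * hsdot Y Y * hsdot Z Z / k.+1%:R ^+ 2.
Proof.
move=> kE; subst k; have [V [VV XY]] := mcoef_fusion i j.
rewrite XY mulr_suml linear_sum (bigD1 m) //=.
rewrite [X in _ + X]big1 => [|l lm]; last first.
  apply: haar_mcoef_right0; apply: contra_neq lm => lm; apply: val_inj => /=.
  by lia.
rewrite addr0 haar_mcoef_right normrM exprMn normfV normr_nat exprVn.
rewrite ler_pM2r ?invr_gt0 ?exprn_gt0 ?ltr0n // -hsdot_tens.
exact: hsdot_compression.
Qed.

Lemma l2norm_mcoef k (X : 'M[C]_k.+1) :
  ((l2norm h (mcoef X (u k)) ^+ 2)%:C)%C = hsdot X X / k.+1%:R.
Proof.
rewrite /l2norm haar_mcoef_left.
(* Being nonnegative, this complex number equals its real part, so the [Re] in [l2norm] loses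
   nothing. *)
have XX : 0 <= hsdot X X / k.+1%:R by rewrite divr_ge0 ?hsdot_ge0 ?ler0n.
rewrite sqr_sqrtr; first by rewrite RRe_real // ger0_real.
by move: XX; rewrite lecE => /andP[].
Qed.

Lemma haar_triple_l2norm i j (m : 'I_(minn i j).+1) k
    (X : 'M[C]_i.+1) (Y : 'M[C]_j.+1) (Z : 'M[C]_k.+1) :
  k = (`|i%:Z - j%:Z| + m.*2)%N ->
  `|h (mcoef X (u i) * mcoef Y (u j) * star (mcoef Z (u k)))|
    <= ((Num.sqrt (dimO i * dimO j / dimO k) * l2norm h (mcoef X (u i))
        * l2norm h (mcoef Y (u j)) * l2norm h (mcoef Z (u k)))%:C)%C.
Proof.
move=> /(haar_triple_le X Y Z) le2.
set la := l2norm h _; set lb := l2norm h _; set lc := l2norm h _.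
set rhs : R := (_ * _ * _ * _)%R.
have rhs_ge0 : 0 <= rhs.
  by rewrite /rhs /la /lb /lc /l2norm !mulr_ge0 ?sqrtr_ge0.
rewrite -(ler_pXn2r (_ : 0 < 2)%N) ?nnegrE ?normr_ge0 // ?ler0c //.
apply: (le_trans le2); rewrite -(rmorphXn (real_complex R)) /=.
have -> : (rhs ^+ 2)%:C%C = (dimO i * dimO j / dimO k : R)%:C%C * (la ^+ 2)%:C%C
    * (lb ^+ 2)%:C%C * (lc ^+ 2)%:C%C.
  rewrite -!(rmorphM (real_complex R)) /rhs !exprMn sqr_sqrtr //.
  by rewrite divr_ge0 ?mulr_ge0 ?ler0n.
rewrite !l2norm_mcoef /dimO !(rmorphM (real_complex R)) /=.
rewrite (fmorphV (real_complex R)) !(rmorph_nat (real_complex R)).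
have i0 : i.+1%:R != 0 :> C by rewrite pnatr_eq0.
have j0 : j.+1%:R != 0 :> C by rewrite pnatr_eq0.
have k0 : k.+1%:R != 0 :> C by rewrite pnatr_eq0.
(* Each squared norm carries the inverse of its dimension, and [1 / d_k^2 = (d_i d_j / d_k) / (d_i
   d_j d_k)]. *)
suff alg (K : fieldType) (x y z a b c : K) : a != 0 -> b != 0 -> c != 0 ->
    x * y * z / c ^+ 2 = a * b / c * (x / a) * (y / b) * (z / c).
  by rewrite -alg.
by move=> a0 b0 c0; field; rewrite a0 b0 c0.
Qed.

End IrrepSystem.

(** * Estimates on the constants *)

Section Numerics.
Variable R : realType.

Lemma dimO_gt0 k : 0 < dimO k :> R.
Proof. exact: ltr0Sn. Qed.

(** The numerator of the second case is written in cyclic order, to match the rotation [c a b] of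
    the product. *)
Lemma ctilde_cases r s t :
  let i := (s + t)%N in let j := (r + t)%N in let k := (r + s)%N in
  [\/ ctilde r s t = Num.sqrt (dimO j * dimO k / dimO i) :> R,
      ctilde r s t = Num.sqrt (dimO k * dimO i / dimO j) :> R
    | ctilde r s t = Num.sqrt (dimO i * dimO j / dimO k) :> R].
Proof.
rewrite /= /ctilde [dimO (r + s) * _]mulrC /Order.min.
by case: ifP => _; [constructor 1|case: ifP => _; [constructor 2|constructor 3]].
Qed.

Lemma ctilde_le r s t :
  let i := (s + t)%N in let j := (r + t)%N in let k := (r + s)%N in
  [/\ ctilde r s t <= Num.sqrt (dimO j * dimO k / dimO i) :> R,
      ctilde r s t <= Num.sqrt (dimO i * dimO k / dimO j) :> R
    & ctilde r s t <= Num.sqrt (dimO i * dimO j / dimO k) :> R].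
Proof. by rewrite /ctilde !ge_min !lexx !orbT. Qed.

(** For [t = 0] the index [k = r + s] has the largest dimension, so the quotient with [d_k] in the
    denominator is the smallest. *)
Lemma ctilde_r0 r s : ctilde r s 0 = eta r s :> R.
Proof.
have aux (x y z : R) : 0 < x -> 0 < y -> x <= z -> x * y / z <= y * z / x.
  move=> x0 y0 xz; have z0 := lt_le_trans x0 xz.
  rewrite ler_pdivrMr // mulrAC ler_pdivlMr // [x * y]mulrC -!mulrA.
  by rewrite ler_pM2l // ler_pM // ltW.
have rk : dimO r <= dimO (r + s) :> R by rewrite ler_nat ltnS leq_addr.
have sk : dimO s <= dimO (r + s) :> R by rewrite ler_nat ltnS leq_addl.
rewrite /ctilde /eta !addn0 [dimO s * dimO r]mulrC.
have -> : Num.min (Num.sqrt (dimO s * dimO (r + s) / dimO r))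
    (Num.sqrt (dimO r * dimO s / dimO (r + s))) =
    Num.sqrt (dimO r * dimO s / dimO (r + s)) :> R.
  by apply: min_r; rewrite ler_wsqrtr // aux ?dimO_gt0.
by apply: min_r; rewrite ler_wsqrtr // [dimO r * dimO s]mulrC aux ?dimO_gt0.
Qed.

Lemma etaC r s : eta r s = eta s r :> R.
Proof. by rewrite /eta addnC [dimO r * _]mulrC. Qed.

(** Write [x, y, z] for the dimensions at [a, b, c] and [d1, d2] for those at [a + b, a + c]. After
    squaring, the claim is [(d1 d2)^2 <= (5/4)^3 (xyz)^2], and the stronger [d1 d2 <= (5/4) xyz]
    holds because [x] is minimal and at least 2. *)
Lemma sqrt_dimO_le_eta a b c : (0 < a)%N -> (a <= b)%N -> (a <= c)%N ->
  Num.sqrt (dimO (a + b) * dimO (a + c) / dimO (b + c)) <=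
  gamma2 ^+ 3 * eta a b * eta a c * eta b c :> R.
Proof.
move=> a0 ab ac.
have rhs_ge0 : 0 <= gamma2 ^+ 3 * eta a b * eta a c * eta b c :> R.
  do 3?[apply: mulr_ge0; last exact: sqrtr_ge0].
  by apply: exprn_ge0; rewrite divr_ge0 ?sqrtr_ge0 ?ler0n.
rewrite -(ler_pXn2r (_ : 0 < 2)%N) ?nnegrE ?sqrtr_ge0 // 3!exprMn.
have pos k l m : 0 <= dimO k * dimO l / dimO m :> R.
  by rewrite divr_ge0 ?mulr_ge0 ?ler0n.
rewrite /eta /gamma2 !sqr_sqrtr // exprAC expr_div_n sqr_sqrtr ?ler0n //.
rewrite ler_pdivrMr ?dimO_gt0 //.
have dD k l : dimO (k + l) = dimO k + dimO l - 1 :> R.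
  by rewrite /dimO -addSn natrD -[l.+1%:R]natr1 addrA addrK.
have D1 := dimO_gt0 (a + b); have D2 := dimO_gt0 (a + c).
have D3 := dimO_gt0 (b + c).
have x2 : 2 <= dimO a :> R by rewrite ler_nat.
have xy : dimO a <= dimO b :> R by rewrite ler_nat.
have xz : dimO a <= dimO c :> R by rewrite ler_nat.
have DE1 := dD a b; have DE2 := dD a c.
move: (dimO (a + b)) (dimO (a + c)) (dimO (b + c)) D1 D2 D3 DE1 DE2 => d1 d2 d3.
move: (dimO a) (dimO b) (dimO c) x2 xy xz => x y z x2 xy xz D1 D2 D3 DE1 DE2.
have le12 : d1 * d2 <= 5 / 4 * (x * y * z).
  have x_gt0 : 0 < x by lra.
  have le1 : x * d1 <= y * (2 * x - 1).
    (* With [d1 = x + y - 1], the difference of the two sides is exactly this product. *)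
    have : 0 <= (y - x) * (x - 1) by apply: mulr_ge0; lra.
    by rewrite DE1; lra.
  have le2 : x * d2 <= z * (2 * x - 1).
    have : 0 <= (z - x) * (x - 1) by apply: mulr_ge0; lra.
    by rewrite DE2; lra.
  have le3 : (2 * x - 1) ^+ 2 <= 5 / 4 * x ^+ 3.
    (* In powers of [x - 2], the polynomial [(5/4) x^3 - (2x - 1)^2] has only positive
       coefficients. *)
    have u1 : 0 <= x - 2 by lra.
    have u2 := mulr_ge0 u1 u1; have u3 := mulr_ge0 u1 u2.
    by lra.
  rewrite -(ler_pM2l (exprn_gt0 2 x_gt0)).
  have le4 : (x * d1) * (x * d2) <= (y * (2 * x - 1)) * (z * (2 * x - 1)).
    by apply: ler_pM => //; rewrite mulr_ge0 // ltW.
  have le5 : (y * z) * (2 * x - 1) ^+ 2 <= (y * z) * (5 / 4 * x ^+ 3).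
    by apply: ler_wpM2l => //; rewrite mulr_ge0 //; lra.
  by move: le4 le5; lra.
have -> : (5 / 2 ^+ 2) ^+ 3 * (x * y / d1) * (x * z / d2) * (y * z / d3) * d3 =
    125 / 64 * (x * y * z) ^+ 2 / (d1 * d2).
  by field; rewrite ?gt_eqF.
rewrite ler_pdivlMr ?mulr_gt0 // -expr2.
have p0 : 0 < d1 * d2 by exact: mulr_gt0.
move: (d1 * d2) (x * y * z) p0 le12 => p q p0 pq.
(* This gives [p^2 <= (25/16) q^2], and [25/16 = 100/64] is below [125/64]. *)
have : 0 <= (5 / 4 * q - p) * (5 / 4 * q + p) by apply: mulr_ge0; lra.
have : 0 <= q * q by rewrite -expr2 sqr_ge0.
by lra.
Qed.

(** The smallest of [r, s, t] selects the term of the minimum: its denominator is the dimension at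
    the sum of the other two, as [sqrt_dimO_le_eta] requires. *)
Lemma ctilde_le_eta r s t : (1 <= r)%N -> (1 <= s)%N -> (1 <= t)%N ->
  ctilde r s t <= gamma2 ^+ 3 * eta r s * eta r t * eta s t :> R.
Proof.
move=> r1 s1 t1; have [le_i le_j le_k] := ctilde_le r s t.
have [[rs rt]|[sr st]|[tr ts]] :
    [\/ r <= s /\ r <= t, s <= r /\ s <= t | t <= r /\ t <= s]%N.
  by case: (leqP r s); case: (leqP r t); case: (leqP s t) => *;
    [constructor 1|constructor 1|constructor 3|constructor 3|constructor 2
    |constructor 3|constructor 2|constructor 3]; lia.
- apply: le_trans le_i _; rewrite [dimO (r + t) * _]mulrC.
  exact: sqrt_dimO_le_eta.
- apply: le_trans le_j _; have := sqrt_dimO_le_eta s1 sr st.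
  rewrite (addnC s r) [dimO (r + s) * _]mulrC (etaC s r).
  by rewrite [X in _ <= X]mulrAC.
- apply: le_trans le_k _; have := sqrt_dimO_le_eta t1 tr ts.
  rewrite (addnC t r) (addnC t s) [dimO (r + t) * _]mulrC (etaC t r) (etaC t s).
  by rewrite [X in _ <= X]mulrAC [X in _ <= X * _]mulrAC.
Qed.

End Numerics.


Theorem lemma4p1 (R : realType) (F : 'M[R[i]]_2)
    (F_unit : F \in unitmx)
    (F_conj : exists2 e : R[i], e = 1 \/ e = -1
                & F *m map_mx Num.conj F = e%:M)
    (F_unitary : cadj F *m F = 1%:M)
    (A T : cstarAlgType R) (iota1 iota2 Delta : {lrmorphism A -> T})
    (w : 'M[A]_2) (OF : is_OFplus F iota1 iota2 Delta w)
    (h : {scalar A}) (haar_h : is_haar iota1 iota2 Delta h)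
    (u : forall k : nat, 'M[A]_k.+1)
    (irr_u : is_irrep_system iota1 iota2 Delta w u) :
  (forall (i j k r s t : nat),
     i = (s + t)%N -> j = (r + t)%N -> k = (r + s)%N ->
     forall a b c : A,
       a \in Vspace u i -> b \in Vspace u j -> c \in Vspace u k ->
       star a = a -> star b = b -> star c = c ->
       `|h (a * b * c)|
         <= (ctilde r s t * l2norm h a * l2norm h b * l2norm h c)%:C) /\
  (forall r s : nat, (1 <= r)%N -> (1 <= s)%N ->
     ctilde r s 0 = eta r s :> R) /\
  (forall r s t : nat, (1 <= r)%N -> (1 <= s)%N -> (1 <= t)%N ->
     ctilde r s t <= gamma2 ^+ 3 * eta r s * eta r t * eta s t :> R).
Proof.
split; last by split=> *; [exact: ctilde_r0|exact: ctilde_le_eta].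
move=> i j k r s t iE jE kE _ _ _ /set_mem[X ->] /set_mem[Y ->] /set_mem[Z ->].
rewrite -!/(mcoef _ _) => aE bE cE.
have le_abc := haar_triple_l2norm F_unit F_unitary OF haar_h irr_u.
have mulC := haar_mulC F_unit F_unitary OF haar_h irr_u.
set a := mcoef X _ in aE *; set b := mcoef Y _ in bE *.
set c := mcoef Z _ in cE *.
(* Self-adjointness lets any of the three factors be the starred last one; its dimension then stands
   in the denominator of the bound. *)
have h1 : h (a * b * c) = h (b * c * star a) by rewrite mulC aE mulrA.
have h2 : h (a * b * c) = h (c * a * star b).
  transitivity (h (star c * (a * b))); first by rewrite -mulC -/a -/b -/c cE.
  by rewrite cE bE mulrA.
have h3 : h (a * b * c) = h (a * b * star c) by rewrite cE.
(* The position of [u k] in the fusion of [u i] and [u j]: |i - j| = |s - r|, and [r + s] exceeds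
   this by twice [minn r s]. The other two are its rotations. *)
have m_ij : (minn r s < (minn i j).+1)%N by lia.
have m_jk : (minn s t < (minn j k).+1)%N by lia.
have m_ki : (minn r t < (minn k i).+1)%N by lia.
case: (@ctilde_cases R r s t) => ->; rewrite -iE -jE -kE.
- have rot (x y z l : R) : x * y * z * l = x * z * l * y by ring.
  by rewrite h1 rot; apply: (le_abc _ _ (Ordinal m_jk)) => /=; lia.
- have rot (x y z l : R) : x * y * z * l = x * l * y * z by ring.
  by rewrite h2 rot; apply: (le_abc _ _ (Ordinal m_ki)) => /=; lia.
- by rewrite h3; apply: (le_abc _ _ (Ordinal m_ij)) => /=; lia.
Qed.
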